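(* For every $n\ge 2$, the sequence of groups $$1\longrightarrow F^3(n-1)\xrightarrow{\ \overline{\tau}\ }A(F^4(n))\longrightarrow A(F^4(n-1))\longrightarrow 1$$ is split exact, where $\overline{\tau}$ is the homomorphism and $A(F^4(n))\to A(F^4(n-1))$ the restriction homomorphism described in the context.
   Context: For a group $G$, let $G_1=G$, $G_{q+1}=[G,G_q]$ be the lower central series and $G^q=G/G_q$. $F(n)$ is the free group on $x_1,\dots,x_n$; $F^q(n)=F(n)/F(n)_q$. $\langle x_n\rangle$ denotes the normal closure of $x_n$ (in whichever quotient $F^q(n)$ is under consideration), so that $F^q(n)/\langle x_n\rangle=F^q(n-1)$. $A(F^q(n))$ is the group of all automorphisms $\alpha$ of $F^q(n)$ such that for each $i$ there is $g_i$ with $\alpha(x_i)=g_ix_ig_i^{-1}$, and such that $\alpha(x_1x_2\cdots x_n)=x_1x_2\cdots x_n$. (The $g_i$ matter only through their classes in $F^{q-1}(n)$.) The product in $A(F^q(n))$ is composition, written left to right: $\alpha\beta$ means first $\alpha$, then $\beta$. The restriction map $A(F^4(n))\to A(F^4(n-1))$ sends $\alpha$ to the automorphism induced on $F^4(n)/\langle x_n\rangle=F^4(n-1)$. The homomorphism $\overline{\tau}:F^3(n-1)\to A(F^4(n))$: for $w\in F^3(n-1)$, $\overline{\tau}(w)$ is the unique $\alpha\in A(F^4(n))$ satisfying $\alpha(x_i)\equiv x_i \bmod \langle x_n\rangle$ for $i<n$ and $\alpha(x_n)=\tilde w x_n\tilde w^{-1}$ for some $\tilde w\in F^3(n)$ with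 $\tilde w\equiv w\bmod\langle x_n\rangle$. (Such an $\alpha$ exists and is unique.) *)

(* Defs.v *)
From HB Require Import structures.
From mathcomp Require Import all_boot.
From mathcomp Require Import boolp classical_sets.

Set Implicit Arguments.
Unset Strict Implicit.
Unset Printing Implicit Defensive.

Local Open Scope group_scope.
Local Open Scope quotient_scope.
Local Open Scope classical_set_scope.

(* Group homomorphisms are the [{multiplicative G -> H}] of monoid.v; between
   groups such a map automatically preserves 1 and inverses. *)

Lemma mult1 (G H : groupType) (f : {multiplicative G -> H}) : f 1 = 1.
Proof. by apply: (@mulgI _ (f 1)); rewrite -gmulfM !mulg1. Qed.

Lemma multV (G H : groupType) (f : {multiplicative G -> H}) x :
  f x^-1 = (f x)^-1.
Proof. by apply: (@mulgI _ (f x)); rewrite -gmulfM !mulgV mult1. Qed.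

Lemma mult_prod (G H : groupType) (f : {multiplicative G -> H})
    (I : Type) (r : seq I) (F : I -> G) :
  f (\prod_(i <- r) F i) = \prod_(i <- r) f (F i).
Proof.
elim: r => [|i r IHr]; first by rewrite !big_nil mult1.
by rewrite !big_cons gmulfM IHr.
Qed.

Lemma multJ (G H : groupType) (f : {multiplicative G -> H}) x y :
  f (x ^ y) = f x ^ f y.
Proof. by rewrite !gmulfM multV. Qed.

Inductive generated (G : groupType) (S : set G) : set G :=
| generated1 : generated S 1
| generated_mem x : S x -> generated S x
| generatedM x y : generated S x -> generated S y -> generated S (x * y)
| generatedV x : generated S x -> generated S x^-1.

Definition normal_closure (G : groupType) (S : set G) : set G :=
  generated [set y | exists2 x, S x & exists g, y = g * x * g^-1].

(* Indexing from 1: G_1 = G and G_(q+1) = [G, G_q] for q >= 1; the value at the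
   unused index 0 is G. *)
Fixpoint lcs (G : groupType) (q : nat) : set G :=
  match q with
  | (_.+1 as q').+1 =>
      generated [set z | exists x y, @lcs G q' y /\ z = [~ x, y]]
  | _ => setT
  end.
Arguments lcs : clear implicits.

Record normal_subgroup (G : groupType) := NormalSubgroup {
  nsub :> G -> Prop;
  nsub1 : nsub 1;
  nsubM : forall x y, nsub x -> nsub y -> nsub (x * y);
  nsubV : forall x, nsub x -> nsub x^-1;
  nsubJ : forall x g, nsub x -> nsub (x ^ g)
}.

Lemma lcs_mult (G H : groupType) (f : {multiplicative G -> H}) q x :
  lcs G q x -> lcs H q (f x).
Proof.
elim: q x => [//|[//|q] IHq] x.
elim=> [|z [u [v [vq ->]]]|u v _ Hu _ Hv|u _ Hu].
- by rewrite mult1; apply: generated1.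
- apply: generated_mem; exists (f u), (f v); split; first exact: IHq.
  by rewrite /commg !(gmulfM, multV, multJ).
- by rewrite gmulfM; apply: generatedM.
- by rewrite multV; apply: generatedV.
Qed.

Section LcsNormal.
Variables (G : groupType) (q : nat).

Lemma lcs1 : lcs G q 1.
Proof. by case: q => [//|[//|q']]; apply: generated1. Qed.

Lemma lcsM x y : lcs G q x -> lcs G q y -> lcs G q (x * y).
Proof. by case: q => [//|[//|q']]; apply: generatedM. Qed.

Lemma lcsV x : lcs G q x -> lcs G q x^-1.
Proof. by case: q => [//|[//|q']]; apply: generatedV. Qed.

Definition conjgr (g x : G) : G := x ^ g.
HB.instance Definition _ (g : G) :=
  isMultiplicative.Build G G (conjgr g) (fun x y => conjMg x y g).

Lemma lcsJ x g : lcs G q x -> lcs G q (x ^ g).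
Proof. exact: (@lcs_mult _ _ (conjgr g)). Qed.

Definition lcs_normal : normal_subgroup G :=
  NormalSubgroup lcs1 lcsM lcsV lcsJ.
End LcsNormal.

Lemma lcsS (G : groupType) q x : lcs G q.+1 x -> lcs G q x.
Proof.
elim: q x => [//|q IHq] x /=.
case: q IHq => [//|q] IHq.
elim=> [|z [u [v [vq ->]]]|u v _ Hu _ Hv|u _ Hu].
- exact: generated1.
- apply: generated_mem; exists u, v; split=> //; exact: IHq.
- exact: generatedM.
- exact: generatedV.
Qed.

Section Quotient.
Variables (G : groupType) (N : normal_subgroup G).

Definition coset_rel : rel G := fun x y => `[< N (x^-1 * y) >].

Lemma coset_rel_refl : reflexive coset_rel.
Proof. by move=> x; apply/asboolP; rewrite mulVg; apply: nsub1. Qed.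

Lemma coset_rel_sym : symmetric coset_rel.
Proof.
suff H x y : coset_rel x y -> coset_rel y x by move=> x y; apply/idP/idP; apply: H.
by move=> /asboolP/nsubV; rewrite invgM invgK => ?; apply/asboolP.
Qed.

Lemma coset_rel_trans : transitive coset_rel.
Proof.
move=> y x z /asboolP Nxy /asboolP Nyz; apply/asboolP.
by have := nsubM Nxy Nyz; rewrite mulgA mulgK.
Qed.

Canonical coset_equiv :=
  EquivRel coset_rel coset_rel_refl coset_rel_sym coset_rel_trans.

Definition quotient : Type := {eq_quot coset_equiv}.
HB.instance Definition _ := Choice.on quotient.
HB.instance Definition _ := EqQuotient.on quotient.

Lemma eq_quotient (x y : G) : \pi_quotient x = \pi_quotient y <-> N (x^-1 * y).
Proof.
split; first by move/eqP; rewrite eqmodE => /asboolP.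
by move=> Nxy; apply/eqP; rewrite eqmodE; apply/asboolP.
Qed.

Definition quotient_one : quotient := \pi_quotient 1.
Definition quotient_inv (x : quotient) : quotient := \pi_quotient (repr x)^-1.
Definition quotient_mul (x y : quotient) : quotient := \pi_quotient (repr x * repr y).

Lemma quotient_repr (x : G) : N (x^-1 * repr (\pi_quotient x)).
Proof. by apply/eq_quotient; rewrite reprK. Qed.

Lemma quotient_piM (x y : G) :
  \pi_quotient (x * y) = quotient_mul (\pi x) (\pi y).
Proof.
apply/eq_quotient; rewrite invgM.
have Nx := quotient_repr x; have Ny := quotient_repr y.
set a := repr _ in Nx *; set b := repr _ in Ny *.
have -> : y^-1 * x^-1 * (a * b) = (x^-1 * a) ^ y * (y^-1 * b).
  by rewrite /conjg -!mulgA mulVKg.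
by apply: nsubM => //; apply: nsubJ.
Qed.

Lemma quotient_piV (x : G) : \pi_quotient x^-1 = quotient_inv (\pi x).
Proof.
apply/eq_quotient; rewrite invgK.
have /nsubV/(nsubJ x^-1) := quotient_repr x.
by rewrite /conjg !invgM !invgK -!mulgA mulgV mulg1.
Qed.

Lemma quotient_mulA : associative quotient_mul.
Proof.
move=> x y z; rewrite -[x]reprK -[y]reprK -[z]reprK.
by rewrite -!quotient_piM mulgA.
Qed.
Lemma quotient_mul1 : left_id quotient_one quotient_mul.
Proof. by move=> x; rewrite -[x]reprK -quotient_piM mul1g. Qed.
Lemma quotient_mulr1 : right_id quotient_one quotient_mul.
Proof. by move=> x; rewrite -[x]reprK -quotient_piM mulg1. Qed.
Lemma quotient_mulV : left_inverse quotient_one quotient_inv quotient_mul.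
Proof. by move=> x; rewrite -[x]reprK -quotient_piV -quotient_piM mulVg. Qed.
Lemma quotient_mulrV : right_inverse quotient_one quotient_inv quotient_mul.
Proof. by move=> x; rewrite -[x]reprK -quotient_piV -quotient_piM mulgV. Qed.

HB.instance Definition _ := isGroup.Build quotient
  quotient_mulA quotient_mul1 quotient_mulr1 quotient_mulV quotient_mulrV.

Definition quotient_pi (x : G) : quotient := \pi_quotient x.
HB.instance Definition _ :=
  isMultiplicative.Build G quotient quotient_pi quotient_piM.
End Quotient.

(* G^q = G / G_q, so that G^(q+1) has nilpotency class at most q. *)
Definition lcquo (G : groupType) (q : nat) : groupType :=
  quotient (lcs_normal G q).

Definition lcpi (G : groupType) (q : nat) : G -> lcquo G q :=
  @quotient_pi G (lcs_normal G q).
HB.instance Definition _ (G : groupType) (q : nat) :=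
  Multiplicative.copy (@lcpi G q) (@quotient_pi G (lcs_normal G q)).

Lemma lcpi_eq (G : groupType) q (x y : G) :
  lcpi q x = lcpi q y <-> lcs G q (x^-1 * y).
Proof. exact: eq_quotient. Qed.

Lemma lcpi_surj (G : groupType) q (u : lcquo G q) : exists x, u = lcpi q x.
Proof. by exists (repr u); rewrite /lcpi /quotient_pi reprK. Qed.

Section LcMap.
Variables (G H : groupType) (q : nat) (f : {multiplicative G -> H}).

Definition lcmap (u : lcquo G q) : lcquo H q := lcpi q (f (repr u)).

Lemma lcmap_pi x : lcmap (lcpi q x) = lcpi q (f x).
Proof.
apply/lcpi_eq; rewrite -multV -gmulfM; apply: lcs_mult.
by apply/lcpi_eq; rewrite /lcpi /quotient_pi reprK.
Qed.

Lemma lcmapM : {morph lcmap : u v / u * v}.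
Proof.
move=> u v; have [x ->] := lcpi_surj u; have [y ->] := lcpi_surj v.
by rewrite -gmulfM !lcmap_pi !gmulfM.
Qed.
HB.instance Definition _ :=
  isMultiplicative.Build (lcquo G q) (lcquo H q) lcmap lcmapM.
End LcMap.
Arguments lcmap {G H} q f u.

Section LcReduction.
Variables (G : groupType) (q : nat).

Definition lcred (u : lcquo G q.+1) : lcquo G q := lcpi q (repr u).

Lemma lcred_pi x : lcred (lcpi q.+1 x) = lcpi q x.
Proof.
apply/lcpi_eq/lcsS.
by apply/lcpi_eq; rewrite /lcpi /quotient_pi reprK.
Qed.

Lemma lcredM : {morph lcred : u v / u * v}.
Proof.
move=> u v; have [x ->] := lcpi_surj u; have [y ->] := lcpi_surj v.
by rewrite -gmulfM !lcred_pi gmulfM.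
Qed.
HB.instance Definition _ :=
  isMultiplicative.Build (lcquo G q.+1) (lcquo G q) lcred lcredM.
End LcReduction.

(* Free groups: words in letters [(x, b)], standing for x if [b] and for x^-1
   otherwise, modulo insertion and deletion of pairs of inverse letters. *)

Inductive word_equiv (X : Type) : seq (X * bool) -> seq (X * bool) -> Prop :=
| word_equiv_refl w : word_equiv w w
| word_equiv_sym w1 w2 : word_equiv w1 w2 -> word_equiv w2 w1
| word_equiv_trans w2 w1 w3 :
    word_equiv w1 w2 -> word_equiv w2 w3 -> word_equiv w1 w3
| word_equiv_cancel w1 w2 x b :
    word_equiv (w1 ++ [:: (x, b), (x, ~~ b) & w2]) (w1 ++ w2).

Section FreeGroup.
Variable X : choiceType.
Implicit Types w : seq (X * bool).

Definition word_rel : rel (seq (X * bool)) := fun w1 w2 => `[< word_equiv w1 w2 >].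

Lemma word_rel_refl : reflexive word_rel.
Proof. by move=> w; apply/asboolP; apply: word_equiv_refl. Qed.

Lemma word_rel_sym : symmetric word_rel.
Proof.
by move=> w1 w2; apply/idP/idP => /asboolP/word_equiv_sym ?; apply/asboolP.
Qed.

Lemma word_rel_trans : transitive word_rel.
Proof.
move=> w2 w1 w3 /asboolP H12 /asboolP H23; apply/asboolP.
exact: word_equiv_trans H12 H23.
Qed.

Canonical word_equiv_rel :=
  EquivRel word_rel word_rel_refl word_rel_sym word_rel_trans.

Definition free : Type := {eq_quot word_equiv_rel}.
HB.instance Definition _ := Choice.on free.
HB.instance Definition _ := EqQuotient.on free.

Lemma eq_free w1 w2 : \pi_free w1 = \pi_free w2 <-> word_equiv w1 w2.
Proof.
split; first by move/eqP; rewrite eqmodE => /asboolP.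
by move=> E; apply/eqP; rewrite eqmodE; apply/asboolP.
Qed.

Lemma free_repr w : word_equiv w (repr (\pi_free w)).
Proof. by apply/eq_free; rewrite reprK. Qed.

Definition word_inv w := rev [seq (l.1, ~~ l.2) | l <- w].

Definition free_one : free := \pi_free [::].
Definition free_inv (g : free) : free := \pi_free (word_inv (repr g)).
Definition free_mul (g h : free) : free := \pi_free (repr g ++ repr h).

Lemma word_equiv_cat w1 w1' w2 w2' :
  word_equiv w1 w1' -> word_equiv w2 w2' -> word_equiv (w1 ++ w2) (w1' ++ w2').
Proof.
move=> H1 H2; apply: (@word_equiv_trans _ (w1' ++ w2)).
  elim: H1 => {H2} [w|w w' _|w w' w'' _ IH _ IH'|w w' x b].
  - exact: word_equiv_refl.
  - exact: word_equiv_sym.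
  - exact: word_equiv_trans IH IH'.
  - by rewrite -!catA; apply: word_equiv_cancel.
elim: H2 => {H1} [w|w w' _|w w' w'' _ IH _ IH'|w w' x b].
- exact: word_equiv_refl.
- exact: word_equiv_sym.
- exact: word_equiv_trans IH IH'.
- by rewrite !catA; apply: word_equiv_cancel.
Qed.

Lemma word_equiv_inv w1 w2 :
  word_equiv w1 w2 -> word_equiv (word_inv w1) (word_inv w2).
Proof.
elim=> [w|w w' _|w w' w'' _ IH _ IH'|w w' x b].
- exact: word_equiv_refl.
- exact: word_equiv_sym.
- exact: word_equiv_trans IH IH'.
- rewrite /word_inv !map_cat !rev_cat /= !rev_cons -!cats1 -!catA /=.
  by rewrite -{2}[b]negbK; apply: word_equiv_cancel.
Qed.

Lemma word_equiv_mulV w : word_equiv (w ++ word_inv w) [::].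
Proof.
elim: w => [|[x b] w IHw]; first exact: word_equiv_refl.
rewrite /word_inv /= rev_cons -cats1 catA.
apply: (@word_equiv_trans _ (([:: (x, b)] ++ [::]) ++ [:: (x, ~~ b)])).
  exact: (word_equiv_cat (word_equiv_cat (word_equiv_refl [:: (x, b)]) IHw)
            (word_equiv_refl [:: (x, ~~ b)])).
exact: (word_equiv_cancel [::] [::]).
Qed.

Lemma word_invK : involutive word_inv.
Proof.
move=> w; rewrite /word_inv map_rev revK -map_comp map_id_in //.
by case=> x b _ /=; rewrite negbK.
Qed.

Lemma free_piM w1 w2 : \pi_free (w1 ++ w2) = free_mul (\pi w1) (\pi w2).
Proof. by apply/eq_free/word_equiv_cat; apply: free_repr. Qed.

Lemma free_piV w : \pi_free (word_inv w) = free_inv (\pi w).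
Proof. by apply/eq_free/word_equiv_inv; apply: free_repr. Qed.

Lemma free_mulA : associative free_mul.
Proof.
by move=> x y z; rewrite -[x]reprK -[y]reprK -[z]reprK -!free_piM catA.
Qed.
Lemma free_mul1 : left_id free_one free_mul.
Proof. by move=> x; rewrite -[x]reprK -free_piM. Qed.
Lemma free_mulr1 : right_id free_one free_mul.
Proof. by move=> x; rewrite -[x]reprK -free_piM cats0. Qed.
Lemma free_mulrV : right_inverse free_one free_inv free_mul.
Proof.
move=> x; rewrite -[x]reprK -free_piV -free_piM.
by apply/eq_free; apply: word_equiv_mulV.
Qed.
Lemma free_mulV : left_inverse free_one free_inv free_mul.
Proof.
move=> x; rewrite -[x]reprK -free_piV -free_piM.
by apply/eq_free; rewrite -{2}[repr x]word_invK; apply: word_equiv_mulV.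
Qed.

HB.instance Definition _ := isGroup.Build free
  free_mulA free_mul1 free_mulr1 free_mulV free_mulrV.

Definition free_gen (x : X) : free := \pi_free [:: (x, true)].

Section Lift.
Variables (G : groupType) (f : X -> G).

Definition word_eval w : G :=
  \prod_(l <- w) (if l.2 then f l.1 else (f l.1)^-1).

Definition free_lift (g : free) : G := word_eval (repr g).

Lemma word_eval_cat w1 w2 : word_eval (w1 ++ w2) = word_eval w1 * word_eval w2.
Proof.
rewrite /word_eval; elim: w1 => [|l w1 IHw] /=; first by rewrite big_nil mul1g.
by rewrite !big_cons IHw mulgA.
Qed.

Lemma word_eval_equiv w1 w2 : word_equiv w1 w2 -> word_eval w1 = word_eval w2.
Proof.
elim=> [//|//|w w' w'' _ -> _ -> //|w w' x b].
rewrite !word_eval_cat -[[:: _, _ & w']]/([:: _; _] ++ w') word_eval_cat.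
rewrite {2}/word_eval !big_cons big_nil mulg1.
by case: b; rewrite /= ?(mulVg, mulgV) mul1g.
Qed.

Lemma free_liftM : {morph free_lift : g h / g * h}.
Proof.
move=> g h; rewrite /free_lift -word_eval_cat; apply: word_eval_equiv.
by apply: word_equiv_sym; apply: free_repr.
Qed.
HB.instance Definition _ := isMultiplicative.Build free G free_lift free_liftM.

Lemma free_lift_gen x : free_lift (free_gen x) = f x.
Proof.
rewrite /free_lift -(word_eval_equiv (free_repr _)).
by rewrite /word_eval big_cons big_nil mulg1.
Qed.
End Lift.

Lemma free_ind (P : free -> Prop) :
  P 1 -> (forall x, P (free_gen x)) -> (forall g, P g -> P g^-1) ->
  (forall g h, P g -> P h -> P (g * h)) -> forall g, P g.
Proof.
move=> P1 Pg PV PM g; rewrite -[g]reprK.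
elim: (repr g) => [//|[x b] w IHw].
have -> : \pi_free ((x, b) :: w) = \pi_free [:: (x, b)] * \pi_free w.
  by rewrite -cat1s free_piM.
apply: PM => //; case: b; first exact: Pg.
have -> : \pi_free [:: (x, false)] = (free_gen x)^-1.
  by rewrite [RHS](esym (free_piV _)).
exact/PV/Pg.
Qed.
End FreeGroup.

Definition Fq (q n : nat) : groupType := lcquo (free 'I_n) q.

Definition Fgen (q n : nat) (i : 'I_n) : Fq q n := lcpi q (free_gen i).

Lemma Fq_ind q n (P : Fq q n -> Prop) :
  P 1 -> (forall i, P (Fgen q i)) -> (forall g, P g -> P g^-1) ->
  (forall g h, P g -> P h -> P (g * h)) -> forall g, P g.
Proof.
move=> P1 Pg PV PM g; have [x ->] := lcpi_surj g; move: x.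
apply: free_ind => [|//|x Hx|x y Hx Hy]; first by rewrite mult1.
- by rewrite multV; apply: PV.
- by rewrite gmulfM; apply: PM.
Qed.

Lemma Fq_hom_ext q n (G : groupType) (f g : {multiplicative Fq q n -> G}) :
  (forall i, f (Fgen q i) = g (Fgen q i)) -> f =1 g.
Proof.
move=> fg; apply: Fq_ind => [|//|x Hx|x y Hx Hy]; first by rewrite !mult1.
- by rewrite !multV Hx.
- by rewrite !gmulfM Hx Hy.
Qed.

Definition Flast (q n : nat) : Fq q n.+1 := Fgen q ord_max.

(* The projection F^q(n.+1) -> F^q(n) killing the last generator and fixing
   the others; by [Fproj_surj] and [Fproj_ker] it identifies
   F^q(n.+1)/<x_last> with F^q(n). *)
Definition Fproj (q n : nat) : {multiplicative Fq q n.+1 -> Fq q n} :=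
  lcmap q (free_lift (fun i : 'I_n.+1 =>
    if unlift ord_max i is Some j then free_gen j else 1)).

Definition Fincl (q n : nat) : {multiplicative Fq q n -> Fq q n.+1} :=
  lcmap q (free_lift (fun i : 'I_n => free_gen (lift ord_max i))).

Lemma Fproj_lift q n (i : 'I_n) : Fproj q n (Fgen q (lift ord_max i)) = Fgen q i.
Proof. by rewrite /Fproj /= /Fgen lcmap_pi /= free_lift_gen liftK. Qed.

Lemma Fproj_last q n : Fproj q n (Flast q n) = 1.
Proof. by rewrite /Fproj /= /Flast /Fgen lcmap_pi /= free_lift_gen unlift_none mult1. Qed.

Lemma Fincl_gen q n (i : 'I_n) : Fincl q n (Fgen q i) = Fgen q (lift ord_max i).
Proof. by rewrite /Fincl /= /Fgen lcmap_pi /= free_lift_gen. Qed.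

Lemma FinclK q n : cancel (Fincl q n) (Fproj q n).
Proof.
apply: (@Fq_hom_ext _ _ _ (Fproj q n \o Fincl q n) idfun) => i /=.
by rewrite Fincl_gen Fproj_lift.
Qed.

Lemma Fproj_surj q n (u : Fq q n) : exists v, Fproj q n v = u.
Proof. by exists (Fincl q n u); rewrite FinclK. Qed.

Lemma normal_closureJ (G : groupType) (S : set G) x g :
  normal_closure S x -> normal_closure S (g * x * g^-1).
Proof.
elim=> [|y [s Ss [h ->]]|y z _ Hy _ Hz|y _ Hy].
- by rewrite mulg1 mulgV; apply: generated1.
- apply: generated_mem; exists s => //; exists (g * h).
  by rewrite invgM !mulgA.
- have -> : g * (y * z) * g^-1 = (g * y * g^-1) * (g * z * g^-1).
    by rewrite !mulgA mulgVK.
  exact: generatedM.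
- have -> : g * y^-1 * g^-1 = (g * y * g^-1)^-1 by rewrite !invgM invgK mulgA.
  exact: generatedV.
Qed.

Lemma Fproj_ker q n (u : Fq q n.+1) :
  Fproj q n u = 1 <-> normal_closure [set Flast q n] u.
Proof.
split=> [pu1|]; last first.
  elim=> [|y [s -> [h ->]]|y z _ Hy _ Hz|y _ Hy]; first exact: mult1.
  - by rewrite !gmulfM multV Fproj_last mulg1 mulgV.
  - by rewrite gmulfM Hy Hz mulg1.
  - by rewrite multV Hy invg1.
suff: normal_closure [set Flast q n] (u * (Fincl q n (Fproj q n u))^-1).
  by rewrite pu1 mult1 invg1 mulg1.
move: u {pu1}; apply: Fq_ind => [|i|g Hg|g h Hg Hh].
- by rewrite !mult1 mulgV; apply: generated1.
- case: (unliftP ord_max i) => [j ->|->].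
    by rewrite Fproj_lift Fincl_gen mulgV; apply: generated1.
  rewrite -/(Flast q n) Fproj_last mult1 invg1 mulg1; apply: generated_mem.
  by exists (Flast q n) => //; exists 1; rewrite mul1g invg1 mulg1.
- rewrite !multV invgK.
  have := normal_closureJ g^-1 (generatedV Hg).
  by rewrite !invgM !invgK mulgA mulgVK.
- rewrite !gmulfM invgM.
  set a := Fincl _ _ _ in Hg *; set b := Fincl _ _ _ in Hh *.
  have -> : g * h * (b^-1 * a^-1) = (g * (h * b^-1) * g^-1) * (g * a^-1).
    by rewrite !mulgA mulgVK.
  by apply: generatedM => //; apply: normal_closureJ.
Qed.

Record aut (G : groupType) := Aut {
  aut_fun :> G -> G;
  aut_morph : {morph aut_fun : x y / x * y};
  aut_bij : bijective aut_fun
}.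

HB.instance Definition _ (G : groupType) := gen_eqMixin (aut G).
HB.instance Definition _ (G : groupType) := gen_choiceMixin (aut G).
HB.instance Definition _ (G : groupType) (a : aut G) :=
  isMultiplicative.Build G G a (aut_morph a).

Section AutGroup.
Variable G : groupType.
Implicit Types a b c : aut G.

Lemma autP a b : a =1 b -> a = b.
Proof.
case: a b => [f fM fB] [g gM gB] /= /funext fg; subst g.
by rewrite (Prop_irrelevance fM gM) (Prop_irrelevance fB gB).
Qed.

Definition aut_one : aut G :=
  @Aut G id (fun x y => erefl) (Bijective (fun x => erefl) (fun x => erefl)).

(* The product is written left to right: [a * b] is first a, then b. *)
Definition aut_mul a b : aut G :=
  @Aut G (fun x => b (a x))
    (fun x y => etrans (congr1 b (aut_morph a x y)) (aut_morph b (a x) (a y)))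
    (bij_comp (aut_bij b) (aut_bij a)).

Lemma aut_inv_exists a : exists b, cancel a b /\ cancel b a.
Proof.
have [g aK gK] := aut_bij a.
have gM : {morph g : x y / x * y} by apply: can2_gmulfM aK gK.
by exists (Aut gM (Bijective gK aK)).
Qed.

Definition aut_inv a : aut G := sval (cid (aut_inv_exists a)).

Lemma aut_mulA : associative aut_mul. Proof. by move=> a b c; apply: autP. Qed.
Lemma aut_mul1 : left_id aut_one aut_mul. Proof. by move=> a; apply: autP. Qed.
Lemma aut_mulr1 : right_id aut_one aut_mul. Proof. by move=> a; apply: autP. Qed.
Lemma aut_mulV : left_inverse aut_one aut_inv aut_mul.
Proof. by move=> a; apply: autP => x /=; rewrite /aut_inv; case: cid => b []. Qed.
Lemma aut_mulrV : right_inverse aut_one aut_inv aut_mul.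
Proof. by move=> a; apply: autP => x /=; rewrite /aut_inv; case: cid => b []. Qed.

HB.instance Definition _ := isGroup.Build (aut G)
  aut_mulA aut_mul1 aut_mulr1 aut_mulV aut_mulrV.

Lemma autME a b x : (a * b) x = b (a x). Proof. by []. Qed.
Lemma aut1E x : (1 : aut G) x = x. Proof. by []. Qed.
Lemma autK a : cancel a (a^-1).
Proof. by move=> x; rewrite -autME mulgV. Qed.
Lemma autVK a : cancel (a^-1) a.
Proof. by move=> x; rewrite -autME mulVg. Qed.
End AutGroup.

Definition conj_on_gens q n (a : aut (Fq q n)) : Prop :=
  forall i, exists g, a (Fgen q i) = g * Fgen q i * g^-1.

Definition fixes_gen_prod q n (a : aut (Fq q n)) : Prop :=
  a (\prod_(i < n) Fgen q i) = \prod_(i < n) Fgen q i.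

Definition Apred q n : pred (aut (Fq q n)) :=
  fun a => `[< conj_on_gens a /\ fixes_gen_prod a >].
Arguments Apred : clear implicits.

Record AFq q n := AFqPack { aval : aut (Fq q n); aval_in : Apred q n aval }.

HB.instance Definition _ q n := [isSub for @aval q n].
HB.instance Definition _ q n := [Choice of AFq q n by <:].

Lemma Apred_closed q n : group_closed (Apred q n).
Proof.
split=> [|a b /asboolP[aC aP] /asboolP[bC bP]]; apply/asboolP.
  by split=> // i; exists 1; rewrite mul1g invg1 mulg1.
split=> [i|]; last by rewrite /fixes_gen_prod autME aP -[in LHS]bP autK.
have [g ag] := aC i; have [h bh] := bC i.
have bVh : b^-1 h * b^-1 (Fgen q i) * (b^-1 h)^-1 = Fgen q i.
  by rewrite -multV -!gmulfM -bh; apply: autK.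
exists (b^-1 (g * h^-1)); rewrite autME ag !gmulfM !multV -[in RHS]bVh.
by rewrite /= invgM invgK !mulgA !mulgVK.
Qed.

HB.instance Definition _ q n :=
  SubChoice_isSubGroup.Build (aut (Fq q n)) (Apred q n) (AFq q n)
    (Apred_closed q n).

(* The restriction map A(F^q(n.+1)) -> A(F^q(n)): the automorphism induced on
   F^q(n.+1)/<x_last> = F^q(n); it is characterised by [restrictE]. *)

Definition restrict_fun q n (a : AFq q n.+1) : Fq q n -> Fq q n :=
  fun u => Fproj q n (val a (Fincl q n u)).

Lemma aut_proj_last q n (a : AFq q n.+1) : Fproj q n (val a (Flast q n)) = 1.
Proof.
have /asboolP[aC _] := valP a; have [g ->] := aC ord_max.
by rewrite !gmulfM multV Fproj_last mulg1 mulgV.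
Qed.

Lemma restrict_funE q n (a : AFq q n.+1) u :
  restrict_fun a (Fproj q n u) = Fproj q n (val a u).
Proof.
have H : (Fproj q n \o val a) \o (Fincl q n \o Fproj q n) =1 Fproj q n \o val a.
  apply: Fq_hom_ext => i /=; case: (unliftP ord_max i) => [j ->|->].
    by rewrite Fproj_lift Fincl_gen.
  by rewrite -/(Flast q n) Fproj_last !mult1 aut_proj_last.
exact: H.
Qed.

Lemma restrict_morph q n (a : AFq q n.+1) :
  {morph restrict_fun a : x y / x * y}.
Proof. by move=> x y; rewrite /restrict_fun !gmulfM. Qed.

Lemma restrict_can q n (a : AFq q n.+1) :
  cancel (restrict_fun a) (restrict_fun a^-1).
Proof.
move=> u; rewrite {2}/restrict_fun restrict_funE.
by rewrite -autME -valM mulgV val1 FinclK.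
Qed.

Lemma restrict_bij q n (a : AFq q n.+1) : bijective (restrict_fun a).
Proof.
exists (restrict_fun a^-1); first exact: restrict_can.
by rewrite -{2}[a]invgK; apply: restrict_can.
Qed.

Definition restrict_aut q n (a : AFq q n.+1) : aut (Fq q n) :=
  Aut (@restrict_morph q n a) (restrict_bij a).

Lemma restrict_in q n (a : AFq q n.+1) : Apred q n (restrict_aut a).
Proof.
have /asboolP[aC aP] := valP a; apply/asboolP; split=> [i|].
  have [g ag] := aC (lift ord_max i); exists (Fproj q n g).
  by rewrite /= /restrict_fun Fincl_gen ag !gmulfM multV Fproj_lift.
have pE : Fproj q n (\prod_(i < n.+1) Fgen q i) = \prod_(i < n) Fgen q i.
  rewrite big_ord_recr gmulfM Fproj_last mulg1 mult_prod; apply: eq_bigr => i _.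
  rewrite -[in RHS]Fproj_lift; congr (Fproj q n (Fgen q _)); apply: val_inj.
  by rewrite /= /bump leqNgt ltn_ord.
by rewrite /fixes_gen_prod -pE /= restrict_funE aP.
Qed.

Definition restrict q n (a : AFq q n.+1) : AFq q n := AFqPack (restrict_in a).

Lemma restrictE q n (a : AFq q n.+1) u :
  val (restrict a) (Fproj q n u) = Fproj q n (val a u).
Proof. exact: restrict_funE. Qed.

Lemma restrictM q n : {morph @restrict q n : a b / a * b}.
Proof.
move=> a b; apply: val_inj; apply: autP => u.
have [v <-] := Fproj_surj u.
rewrite restrictE valM autME -!restrictE.
by rewrite [in RHS]valM autME.
Qed.

HB.instance Definition _ q n :=
  isMultiplicative.Build (AFq q n.+1) (AFq q n) (@restrict q n) (@restrictM q n).

(* [is_taubar w a]: the automorphism [a] satisfies the conditions that define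
   taubar(w). The last generator of F^(q+1)(n.+1) is conjugated by an element
   [wt] of F^q(n.+1), i.e. by any lift [g] of [wt] to F^(q+1)(n.+1): the
   result does not depend on the lift, since F_q/F_(q+1) is central. *)
Definition is_taubar q n (w : Fq q n) (a : AFq q.+1 n.+1) : Prop :=
  (forall i : 'I_n,
     normal_closure [set Flast q.+1 n]
       (val a (Fgen q.+1 (lift ord_max i)) * (Fgen q.+1 (lift ord_max i))^-1)) /\
  exists wt : Fq q n.+1, Fproj q n wt = w /\
    exists g : Fq q.+1 n.+1, lcred g = wt /\
      val a (Flast q.+1 n) = g * Flast q.+1 n * g^-1.

Definition exact_at (G H K : groupType) (f : {multiplicative G -> H})
    (g : {multiplicative H -> K}) : Prop :=
  range f = [set h | g h = 1].

(* Split exactness of 1 -> G -> H -> K -> 1; exactness at G and at K are the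
   injectivity of f and the surjectivity of g. *)
Definition split_exact (G H K : groupType) (f : {multiplicative G -> H})
    (g : {multiplicative H -> K}) : Prop :=
  [/\ injective f, exact_at f g, forall k, exists h, g h = k &
      exists s : {multiplicative K -> H}, cancel s g].

(* Main.v *)
Require Import Defs.
From HB Require Import structures.
From mathcomp Require Import all_boot ssralg ssrint ring zify.
From mathcomp Require Import boolp classical_sets.

(* Existence and exactness are formal once tau-bar is seen as a relation
   compatible with products: on a generator x_j it is realised by the pure
   braid in which strand n goes once around strand j, and the splitting extends
   an automorphism by x_n |-> x_n. The point is that an automorphism a of
   F^4(n) restricting to the identity and conjugating x_n by an element trivial
   in F^3(n-1) is the identity. Writing a(x_i) = g_i x_i g_i^-1, let a_ij and
   b_ijk be the Magnus coefficients of g_i in degrees one and two. Invariance of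
   x_1...x_n says that a_ij is symmetric and, once the a_ij vanish, that b_ijk
   is cyclically invariant; it is also alternating in j, k. The entries with no
   index n vanish because a restricts to the identity, those with i = n by
   assumption on g_n, hence all of them do. Finally an element of F(n) whose
   Magnus coefficients of degree one and two vanish lies in F(n)_3. *)

Set Implicit Arguments.
Unset Strict Implicit.
Unset Printing Implicit Defensive.

Import GRing.Theory.
Local Open Scope group_scope.

(* The unit 1 + sum f_i X_i + sum f_ij X_i X_j + sum f_ijk X_i X_j X_k of the ring
   of noncommutative power series truncated at degree four. *)
Record magnus (I : Type) := Magnus {
  mag1 : I -> int;
  mag2 : I -> I -> int;
  mag3 : I -> I -> I -> int
}.

HB.instance Definition _ (I : Type) := gen_eqMixin (magnus I).
HB.instance Definition _ (I : Type) := gen_choiceMixin (magnus I).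

(** * Truncated noncommutative power series as a group *)

Section MagnusGroup.
Variable I : Type.
Implicit Types f g h : magnus I.
Local Open Scope ring_scope.

Lemma magnusP f g :
  (forall i, mag1 f i = mag1 g i) -> (forall i j, mag2 f i j = mag2 g i j) ->
  (forall i j k, mag3 f i j k = mag3 g i j k) -> f = g.
Proof.
case: f g => [f1 f2 f3] [g1 g2 g3] /= E1 E2 E3; congr Magnus.
- exact/funext.
- by do 2!apply/funext => ?; apply: E2.
- by do 3!apply/funext => ?; apply: E3.
Qed.

Definition magnus_one : magnus I := Magnus (fun=> 0) (fun _ _ => 0) (fun _ _ _ => 0).

Definition magnus_mul f g : magnus I := Magnus
  (fun i => mag1 f i + mag1 g i)
  (fun i j => mag2 f i j + mag1 f i * mag1 g j + mag2 g i j)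
  (fun i j k => mag3 f i j k + mag2 f i j * mag1 g k
                + mag1 f i * mag2 g j k + mag3 g i j k).

(** The truncated geometric series [1 - u + u^2 - u^3], where [f = 1 + u]. *)
Definition magnus_inv f : magnus I := Magnus
  (fun i => - mag1 f i)
  (fun i j => mag1 f i * mag1 f j - mag2 f i j)
  (fun i j k => mag2 f i j * mag1 f k + mag1 f i * mag2 f j k
                - mag1 f i * mag1 f j * mag1 f k - mag3 f i j k).

Lemma magnus_mulA : associative magnus_mul.
Proof. by move=> f g h; apply: magnusP => * /=; ring. Qed.
Lemma magnus_mul1 : left_id magnus_one magnus_mul.
Proof. by move=> f; apply: magnusP => * /=; ring. Qed.
Lemma magnus_mulr1 : right_id magnus_one magnus_mul.
Proof. by move=> f; apply: magnusP => * /=; ring. Qed.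
Lemma magnus_mulV : left_inverse magnus_one magnus_inv magnus_mul.
Proof. by move=> f; apply: magnusP => * /=; ring. Qed.
Lemma magnus_mulrV : right_inverse magnus_one magnus_inv magnus_mul.
Proof. by move=> f; apply: magnusP => * /=; ring. Qed.
End MagnusGroup.

HB.instance Definition _ (I : Type) := isGroup.Build (magnus I)
  (@magnus_mulA I) (@magnus_mul1 I) (@magnus_mulr1 I)
  (@magnus_mulV I) (@magnus_mulrV I).

(** * Magnus coefficients along the lower central series *)

Section MagnusCoefficients.
Variable I : Type.
Implicit Types (f g : magnus I) (i j k : I).

Lemma mag1M f g i : mag1 (f * g) i = (mag1 f i + mag1 g i)%R. Proof. by []. Qed.
Lemma mag2M f g i j :
  mag2 (f * g) i j = (mag2 f i j + mag1 f i * mag1 g j + mag2 g i j)%R.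
Proof. by []. Qed.
Lemma mag3M f g i j k :
  mag3 (f * g) i j k = (mag3 f i j k + mag2 f i j * mag1 g k
                        + mag1 f i * mag2 g j k + mag3 g i j k)%R.
Proof. by []. Qed.

Lemma mag1V f i : mag1 f^-1 i = (- mag1 f i)%R. Proof. by []. Qed.
Lemma mag2V f i j : mag2 f^-1 i j = (mag1 f i * mag1 f j - mag2 f i j)%R.
Proof. by []. Qed.

Lemma mag3V f i j k :
  mag3 f^-1 i j k = (mag2 f i j * mag1 f k + mag1 f i * mag2 f j k
                     - mag1 f i * mag1 f j * mag1 f k - mag3 f i j k)%R.
Proof. by []. Qed.

Lemma mag1_1 i : mag1 1 i = 0%R. Proof. by []. Qed.
Lemma mag2_1 i j : mag2 1 i j = 0%R. Proof. by []. Qed.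

Lemma mag1R f g i : mag1 [~ f, g] i = 0%R.
Proof. by rewrite /commg /conjg !(mag1M, mag1V); ring. Qed.

(** Compare degree two in [f * g = g * f * [~ f, g]]: the commutator has no linear part, so its
    quadratic part is the Lie bracket of the linear parts. *)
Lemma mag2R f g i j :
  mag2 [~ f, g] i j = (mag1 f i * mag1 g j - mag1 g i * mag1 f j)%R.
Proof.
have : mag2 (f * g) i j = mag2 (g * f * [~ f, g]) i j by rewrite -commgC.
rewrite !(mag2M, mag1M, mag1R) mulr0 addr0 => E; lia.
Qed.

Lemma mag1_lcs f i : lcs (magnus I) 2 f -> mag1 f i = 0%R.
Proof.
elim=> [//|_ [u [v [_ ->]]]|u v _ Hu _ Hv|u _ Hu]; first exact: mag1R.
- by rewrite mag1M Hu Hv.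
- by rewrite mag1V Hu.
Qed.

Lemma mag2_lcs f i j : lcs (magnus I) 3 f -> mag2 f i j = 0%R.
Proof.
(* Degree two is additive only where degree one vanishes, so both claims go through the induction
   together. *)
move=> Lf; suff [] : mag2 f i j = 0%R /\ forall k, mag1 f k = 0%R by [].
elim: Lf => [//|_ [u [v [Lv ->]]]|u v _ [Hu Hu1] _ [Hv Hv1]|u _ [Hu Hu1]]; split.
- by rewrite mag2R !(mag1_lcs _ Lv); ring.
- by move=> k; apply: mag1R.
- by rewrite mag2M Hu Hv Hu1; ring.
- by move=> k; rewrite mag1M Hu1 Hv1.
- by rewrite mag2V Hu !Hu1; ring.
- by move=> k; rewrite mag1V Hu1.
Qed.

(** An element of the third term is [1] plus terms of degree three, which truncation makes central,
    so all its commutators are trivial. *)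
Lemma magnus_lcs4 f : lcs (magnus I) 4 f -> f = 1.
Proof.
elim=> [//|_ [u [v [Lv ->]]]|u v _ -> _ ->|u _ ->]; rewrite ?mulg1 ?invg1 //.
have v1 i : mag1 v i = 0%R by apply/mag1_lcs/lcsS.
have v2 i j : mag2 v i j = 0%R by apply: mag2_lcs.
apply/eqP/commgP/magnusP => *; rewrite !(mag1M, mag2M, mag3M) !(v1, v2); ring.
Qed.
End MagnusCoefficients.

(** * The Magnus expansion [x |-> 1 + X_x] of a free group *)

Lemma multR (G H : groupType) (f : {multiplicative G -> H}) x y :
  f [~ x, y] = [~ f x, f y].
Proof. by rewrite gmulfM multV multJ. Qed.

Definition free_magnus (X : choiceType) : {multiplicative free X -> magnus X} :=
  free_lift (fun x => Magnus (fun y => (x == y)%:R%R) (fun _ _ => 0%R)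
                             (fun _ _ _ => 0%R)).

Arguments free_magnus : simpl never.

Lemma free_magnus_gen (X : choiceType) (x : X) :
  free_magnus X (free_gen x) =
  Magnus (fun y => (x == y)%:R%R) (fun _ _ => 0%R) (fun _ _ _ => 0%R).
Proof. exact: free_lift_gen. Qed.

(* The degree two part of the shuffle relations; the diagonal correction is
   there because generators are sent to 1 + X_i rather than to exp X_i. *)
Lemma free_magnus_shuffle (X : choiceType) (g : free X) x y :
  let f := free_magnus X g in
  (mag2 f x y + mag2 f y x = mag1 f x * mag1 f y - (x == y)%:R * mag1 f x)%R.
Proof.
move=> f; rewrite {}/f; set d : int := (x == y)%:R%R.
elim/free_ind: g => [|z|g Hg|g h Hg Hh].
- by rewrite mult1 !mag1_1 !mag2_1; ring.
- rewrite free_magnus_gen /= /d; have [->|nxy] := eqVneq x y.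
    by case: (z == y) => /=; ring.
  by have [->|_] := eqVneq z x ; rewrite ?(negPf nxy) /=; ring.
- move/(canRL (addKr _)): Hg => Hg.
  by rewrite multV !mag1V !mag2V Hg; ring.
- move/(canRL (addKr _)): Hg => Hg; move/(canRL (addKr _)): Hh => Hh.
  by rewrite gmulfM !mag1M !mag2M Hg Hh; ring.
Qed.

(** * Central elements in additive notation; expansion of additive and alternating maps *)

Section Center.
Variable G : groupType.

(** Additive notation makes [\sum] and integer multiples available for products and powers of
    central commutators. *)
Record center := Center { cval : G; cvalP : `[< forall y, commute cval y >] }.
HB.instance Definition _ := [isSub for cval].
HB.instance Definition _ := [Choice of center by <:].

Lemma cval_commute (x : center) y : commute (cval x) y.
Proof. by have /asboolP := cvalP x. Qed.

Definition center0 : center := Center (asboolT (fun y => commute_sym (commute1 y))).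
Definition centerN (x : center) : center :=
  Center (asboolT (fun y => commute_sym (commuteV (commute_sym (cval_commute x y))))).
Definition centerD (x y : center) : center :=
  Center (asboolT (fun z => commute_sym (commuteM
    (commute_sym (cval_commute x z)) (commute_sym (cval_commute y z))))).

Lemma centerDA : associative centerD.
Proof. by move=> x y z; apply: val_inj; apply: mulgA. Qed.
Lemma centerDC : commutative centerD.
Proof. by move=> x y; apply: val_inj; apply: cval_commute. Qed.
Lemma center0D : left_id center0 centerD.
Proof. by move=> x; apply: val_inj; apply: mul1g. Qed.
Lemma centerND : left_inverse center0 centerN centerD.
Proof. by move=> x; apply: val_inj; apply: mulVg. Qed.
HB.instance Definition _ :=
  GRing.isZmodule.Build center centerDA centerDC center0D centerND.

Lemma cvalD (x y : center) : cval (x + y)%R = cval x * cval y. Proof. by []. Qed.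
Lemma cvalN (x : center) : cval (- x)%R = (cval x)^-1. Proof. by []. Qed.
End Center.

Lemma lcpiM (G : groupType) q (x y : G) : lcpi q (x * y) = lcpi q x * lcpi q y.
Proof. exact: gmulfM. Qed.

Lemma lcpiV (G : groupType) q (x : G) : lcpi q x^-1 = (lcpi q x)^-1.
Proof. exact: multV. Qed.

Lemma lcpi1 (G : groupType) q (x : G) : lcpi q x = 1 <-> lcs G q x.
Proof.
rewrite -(mult1 (@lcpi G q)); split=> [/esym/lcpi_eq|Lx]; first by rewrite invg1 mul1g.
by apply/esym/lcpi_eq; rewrite invg1 mul1g.
Qed.

Lemma lcsR (G : groupType) q (x y : G) : lcs G q.+1 y -> lcs G q.+2 [~ x, y].
Proof. by move=> Ly; apply: generated_mem; exists x, y. Qed.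

Lemma lcpi_commute (G : groupType) q (x : G) (u : lcquo G q.+2) :
  lcs G q.+1 x -> commute (lcpi q.+2 x) u.
Proof.
have [y ->] := lcpi_surj u => Lx; apply: commute_sym; apply/commgP/eqP.
by rewrite -multR; apply/lcpi1/lcsR.
Qed.

Section Expansion.
Variables (n : nat) (V : zmodType).
Local Notation mu := (free_magnus 'I_n).
Local Notation x_ i := (free_gen (i : 'I_n)).

(** Such a map factors through the abelianization, where the degree one Magnus coefficients are the
    exponent sums. *)
Lemma additive_expand (a : free 'I_n -> V) :
  (forall g h, a (g * h) = (a g + a h)%R) ->
  forall g, a g = (\sum_i a (x_ i) *~ mag1 (mu g) i)%R.
Proof.
move=> aM; have a1 : a 1 = 0%R by apply: (@addrI _ (a 1)); rewrite -aM mulg1 addr0.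
have aN g : a g^-1 = (- a g)%R by apply/eqP; rewrite -addr_eq0 -aM mulVg a1.
elim/free_ind => [|j|g Hg|g h Hg Hh].
- by rewrite mult1 big1 // => i _; rewrite mulr0z.
- rewrite free_magnus_gen (bigD1 j) //= eqxx mulr1z big1 ?addr0 // => i /negPf nij.
  by rewrite eq_sym nij mulr0z.
- rewrite aN Hg -sumrN; apply: eq_bigr => i _.
  by rewrite multV mag1V mulrNz.
- rewrite aM Hg Hh -big_split; apply: eq_bigr => i _.
  by rewrite gmulfM mag1M mulrzDr.
Qed.

(** Expanding both arguments and pairing [(i, j)] with [(j, i)] leaves the minors of the linear
    parts; by [mag2R] these are the quadratic coefficients of [[~ f, g]]. *)
Lemma alternating_expand (A : free 'I_n -> free 'I_n -> V) :
  (forall f g h, A (f * g) h = (A f h + A g h)%R) ->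
  (forall f g, A f g = - A g f)%R -> (forall f, A f f = 0%R) ->
  forall f g, A f g = (\sum_(i < n) \sum_(j < n | (i < j)%N)
    A (x_ i) (x_ j) *~ (mag1 (mu f) i * mag1 (mu g) j - mag1 (mu g) i * mag1 (mu f) j))%R.
Proof.
move=> AM AN A0 f g; set c := fun i j : 'I_n => A (x_ i) (x_ j).
have AMr h f1 f2 : A h (f1 * f2) = (A h f1 + A h f2)%R.
  by rewrite AN AM opprD -!AN.
have -> : A f g = (\sum_i \sum_j c i j *~ (mag1 (mu f) i * mag1 (mu g) j))%R.
  rewrite (additive_expand (a := A^~ g)) //; apply: eq_bigr => i _.
  rewrite (additive_expand (AMr _)) mulrz_suml; apply: eq_bigr => j _.
  by rewrite -mulrzA mulrC.
have split_lt (F : 'I_n -> V) i : F i = 0%R ->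
    (\sum_j F j = \sum_(j < n | (i < j)%N) F j + \sum_(j < n | (j < i)%N) F j)%R.
  move=> Fi; rewrite (bigID (fun j : 'I_n => (i < j)%N)) /=; congr (_ + _)%R.
  rewrite (bigD1 i) ?ltnn //= Fi add0r; apply: eq_bigl => j.
  by rewrite -leqNgt ltn_neqAle andbC.
under eq_bigr => i _ do rewrite (split_lt _ i) ?A0 ?mul0rz ?/c ?A0 ?mul0rz //.
(* The lower triangle is transposed, so that antisymmetry can merge it with the upper one. *)
rewrite big_split /= addrC (exchange_big_dep predT) //= addrC -big_split.
apply: eq_bigr => i _ /=; rewrite -big_split; apply: eq_bigr => j _ /=.
by rewrite mulrzBr (AN (x_ j)) mulNrz [(mag1 (mu g) i * _)%R]mulrC.
Qed.
End Expansion.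

(** * Elements whose low-degree Magnus coefficients vanish *)

Section MagnusKernel.
Variable n : nat.
Implicit Type g : free 'I_n.
Local Notation mu := (free_magnus 'I_n).

Lemma mag1_eq0_lcs g : (forall i, mag1 (mu g) i = 0%R) -> lcs (free 'I_n) 2 g.
Proof.
move=> g0; apply/lcpi1.
(* [F / F_2] is abelian, so every class is central; [Logic.I] proves membership in [F_1], which is
   all of [F]. *)
pose c x : center (lcquo (free 'I_n) 2) :=
  Center (asboolT (fun y => @lcpi_commute _ 0 x y Logic.I)).
have cM g1 g2 : c (g1 * g2) = (c g1 + c g2)%R by apply/val_inj/lcpiM.
rewrite -[lcpi 2 g]/(cval (c g)) (additive_expand cM) big1 // => i _.
by rewrite g0.
Qed.

(** The class in [F / F_3] of an element of [F_2] is the product over [i < j] of the commutators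
    [[~ x_i, x_j]], each raised to the power [mag2] at [i, j]. *)
Lemma mag2_eq0_lcs g : (forall i, mag1 (mu g) i = 0%R) ->
  (forall i j, mag2 (mu g) i j = 0%R) -> lcs (free 'I_n) 3 g.
Proof.
move=> /mag1_eq0_lcs Lg g0; apply/lcpi1.
have cR x y (u : lcquo (free 'I_n) 3) : commute (lcpi 3 [~ x, y]) u.
  by apply: lcpi_commute; apply: lcsR.
pose c x y := Center (asboolT (cR x y)).
pose S (b : 'I_n -> 'I_n -> int) : center (lcquo (free 'I_n) 3) :=
  (\sum_(i < n) \sum_(j < n | (i < j)%N) c (free_gen i) (free_gen j) *~ b i j)%R.
have SD b1 b2 b : (forall i j, b i j = b1 i j + b2 i j)%R -> S b = (S b1 + S b2)%R.
  move=> bD; rewrite /S -big_split; apply: eq_bigr => i _ /=.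
  by rewrite -big_split; apply: eq_bigr => j _; rewrite bD mulrzDr.
have S0 b : (forall i j, b i j = 0%R) -> S b = 0%R.
  by move=> b0; rewrite /S big1 // => i _; rewrite big1 // => j _; rewrite b0 mulr0z.
have SN b1 b : (forall i j, b i j = - b1 i j)%R -> S b = (- S b1)%R.
  move=> bN; apply/eqP; rewrite -addr_eq0 -(SD b b1 (fun _ _ => 0%R)) ?S0 // => i j.
  by rewrite bN addNr.
suff -> : lcpi 3 g = cval (S (mag2 (mu g))) by rewrite S0.
have m1 h i : lcs (free 'I_n) 2 h -> mag1 (mu h) i = 0%R.
  by move=> Lh; apply/mag1_lcs/lcs_mult.
(* On [F_2] the linear part vanishes, so [mag2] is additive and only the case of one commutator has
   content. *)
elim: Lg => {g g0} [|_ [u [v [_ ->]]]|u v Lu Hu Lv Hv|u Lu Hu].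
- by rewrite !mult1 S0.
(* Modulo [F_3] the commutator is bilinear and alternating, so [alternating_expand] applies to
   it. *)
- have cM f g h : c (f * g) h = (c f h + c g h)%R.
    apply: val_inj; rewrite /= -[RHS]/(lcpi 3 [~ f, h] * lcpi 3 [~ g, h]).
    have -> : [~ f * g, h] = [~ f, h] ^ g * [~ g, h].
      by rewrite /commg /conjg !invgM !mulgA !mulgK.
    move: [~ f, h] [~ g, h] (cR f h) => a b Ca.
    by rewrite lcpiM /conjg !lcpiM Ca lcpiV mulKg.
  have cN f g : c f g = (- c g f)%R.
    apply: val_inj; rewrite /= -[RHS]/((lcpi 3 [~ g, f])^-1) -lcpiV.
    by rewrite /commg /conjg !invgM !invgK !mulgA.
  have c0 f : c f f = 0%R.
    by apply: val_inj; rewrite /= commgg mult1.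
  rewrite -[LHS]/(cval (c u v)) (alternating_expand cM cN c0); congr cval.
  apply: eq_bigr => i _; apply: eq_bigr => j _.
  by rewrite multR mag2R.
- rewrite lcpiM Hu Hv -cvalD -(SD _ _ (mag2 (mu (u * v)))) // => i j.
  by rewrite gmulfM mag2M m1 // mul0r addr0.
- rewrite lcpiV Hu -cvalN -(SN _ (mag2 (mu u^-1))) // => i j.
  by rewrite multV mag2V m1 // mul0r add0r.
Qed.
End MagnusKernel.

(** * Magnus coefficients on [F^4(n)] and on conjugates of generators *)

Definition magnus_pull (I J : Type) (f : I -> J) (m : magnus J) : magnus I :=
  Magnus (fun i => mag1 m (f i)) (fun i j => mag2 m (f i) (f j))
         (fun i j k => mag3 m (f i) (f j) (f k)).
HB.instance Definition _ (I J : Type) (f : I -> J) :=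
  isMultiplicative.Build (magnus J) (magnus I) (magnus_pull f) (fun _ _ => erefl).

Section FqMagnus.
Variable n : nat.
Implicit Types (u v : Fq 4 n) (i j k : 'I_n).

Definition Fmagnus u : magnus 'I_n := free_magnus 'I_n (repr u).

(** The choice of representative is harmless, because [magnus_lcs4] makes the expansion trivial on
    [F_4]. *)
Lemma Fmagnus_pi (g : free 'I_n) : Fmagnus (lcpi 4 g) = free_magnus 'I_n g.
Proof.
have /(lcs_mult (free_magnus 'I_n))/magnus_lcs4 : lcs (free 'I_n) 4 (g^-1 * repr (lcpi 4 g)).
  exact: (quotient_repr (lcs_normal _ 4)).
by rewrite gmulfM multV => E; apply/esym; rewrite -[LHS]mulg1 -E mulVKg.
Qed.

Lemma FmagnusM : {morph Fmagnus : u v / u * v}.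
Proof.
move=> u v; have [x ->] := lcpi_surj u; have [y ->] := lcpi_surj v.
by rewrite -lcpiM !Fmagnus_pi gmulfM.
Qed.
HB.instance Definition _ := isMultiplicative.Build (Fq 4 n) (magnus 'I_n) Fmagnus FmagnusM.

Lemma Fmagnus_gen i : Fmagnus (Fgen 4 i) =
  Magnus (fun j => (i == j)%:R%R) (fun _ _ => 0%R) (fun _ _ _ => 0%R).
Proof. by rewrite Fmagnus_pi free_magnus_gen. Qed.

Lemma lcred_eq1 u : lcred u = 1 <->
  (forall i, mag1 (Fmagnus u) i = 0%R) /\ (forall i j, mag2 (Fmagnus u) i j = 0%R).
Proof.
have [g ->] := lcpi_surj u; rewrite lcred_pi Fmagnus_pi; split=> [/lcpi1 Lg|[g1 g2]].
  have Lm : lcs (magnus 'I_n) 3 (free_magnus 'I_n g) by apply: lcs_mult.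
  by split=> [i|i j]; [apply/mag1_lcs/lcsS | apply: mag2_lcs].
exact/lcpi1/mag2_eq0_lcs.
Qed.

Lemma lcred_eq1_commute u v : lcred u = 1 -> commute u v.
Proof.
have [g ->] := lcpi_surj u; rewrite lcred_pi => /lcpi1; exact: lcpi_commute.
Qed.

Lemma Fmagnus_alternating u : (forall i, mag1 (Fmagnus u) i = 0%R) ->
  forall i j, mag2 (Fmagnus u) i j = (- mag2 (Fmagnus u) j i)%R.
Proof.
move=> u1 i j; have := free_magnus_shuffle (repr u) i j.
rewrite /= -/(Fmagnus u) !u1 !(mul0r, mulr0) subr0 => /eqP.
by rewrite addr_eq0 => /eqP.
Qed.

Section Conjugate.
Variables (i : 'I_n) (g : Fq 4 n).
Let u := g * Fgen 4 i * g^-1.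
Local Open Scope ring_scope.

Lemma mag1_conj j : mag1 (Fmagnus u) j = (i == j)%:R.
Proof.
rewrite !FmagnusM multV Fmagnus_gen !mag1M mag1V /=; ring.
Qed.

Lemma mag2_conj j k : mag2 (Fmagnus u) j k =
  mag1 (Fmagnus g) j * (i == k)%:R - (i == j)%:R * mag1 (Fmagnus g) k.
Proof.
rewrite !FmagnusM multV Fmagnus_gen !(mag1M, mag2M, mag1V, mag2V) /=; ring.
Qed.

(** This is degree three of [u * g = g * x_i], solved for [u]; the last term disappears once [g] has
    no linear part. *)
Lemma mag3_conj j k l : mag3 (Fmagnus u) j k l =
  mag2 (Fmagnus g) j k * (i == l)%:R - (i == j)%:R * mag2 (Fmagnus g) k l
  - mag2 (Fmagnus u) j k * mag1 (Fmagnus g) l.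
Proof.
rewrite mag2_conj !FmagnusM multV Fmagnus_gen.
rewrite !(mag1M, mag2M, mag3M, mag1V, mag2V, mag3V) /=; ring.
Qed.
End Conjugate.
End FqMagnus.

(** * Coefficients of products, and compatibility with the projection *)

Section Products.
Variable I J : Type.
Implicit Types (r : seq I) (F G : I -> magnus J).
Local Open Scope ring_scope.

(** When the factors agree in lower degree, their top-degree differences meet only the constant
    terms [1] of the other factors, hence simply add up. *)
Lemma mag2_prod r F G j k : (forall i j, mag1 (F i) j = mag1 (G i) j) ->
  mag2 (\prod_(i <- r) F i)%g j k - mag2 (\prod_(i <- r) G i)%g j k =
  \sum_(i <- r) (mag2 (F i) j k - mag2 (G i) j k).
Proof.
move=> E1; suff [] : mag2 (\prod_(i <- r) F i)%g j k - mag2 (\prod_(i <- r) G i)%g j k =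
  \sum_(i <- r) (mag2 (F i) j k - mag2 (G i) j k) /\
  forall j, mag1 (\prod_(i <- r) F i)%g j = mag1 (\prod_(i <- r) G i)%g j by [].
elim: r => [|i r [IH2 IH1]]; first by rewrite !big_nil subrr.
rewrite !big_cons; split=> [|l]; last by rewrite !mag1M E1 IH1.
by rewrite -IH2 !mag2M E1 IH1; ring.
Qed.

Lemma mag3_prod r F G j k l : (forall i j, mag1 (F i) j = mag1 (G i) j) ->
  (forall i j k, mag2 (F i) j k = mag2 (G i) j k) ->
  mag3 (\prod_(i <- r) F i)%g j k l - mag3 (\prod_(i <- r) G i)%g j k l =
  \sum_(i <- r) (mag3 (F i) j k l - mag3 (G i) j k l).
Proof.
move=> E1 E2.
suff [] : mag3 (\prod_(i <- r) F i)%g j k l - mag3 (\prod_(i <- r) G i)%g j k l =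
  \sum_(i <- r) (mag3 (F i) j k l - mag3 (G i) j k l) /\
  ((forall j, mag1 (\prod_(i <- r) F i)%g j = mag1 (\prod_(i <- r) G i)%g j) /\
  forall j k, mag2 (\prod_(i <- r) F i)%g j k = mag2 (\prod_(i <- r) G i)%g j k) by [].
elim: r => [|i r [IH3 [IH1 IH2]]]; first by rewrite !big_nil subrr.
rewrite !big_cons; split; [|split=> [a|a b]].
- by rewrite -IH3 !mag3M E1 E2 IH1 IH2; ring.
- by rewrite !mag1M E1 IH1.
- by rewrite !mag2M E1 E2 IH1 IH2.
Qed.
End Products.

(** Killing the last generator sets its variable to zero, which keeps just the coefficients of words
    without the last letter. *)
Lemma Fmagnus_proj n (u : Fq 4 n.+1) :
  Fmagnus (Fproj 4 n u) = magnus_pull (lift ord_max) (Fmagnus u).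
Proof.
apply: (@Fq_hom_ext _ _ _ (@Fmagnus n \o Fproj 4 n)
          (magnus_pull (lift ord_max) \o @Fmagnus n.+1)) => i /=.
rewrite Fmagnus_gen; case: (unliftP ord_max i) => [j ->|->].
  rewrite Fproj_lift Fmagnus_gen /magnus_pull /=; apply: magnusP => //= k.
  by rewrite (inj_eq lift_inj).
rewrite Fproj_last mult1; apply: magnusP => // k.
by rewrite [RHS]/mag1 /= -val_eqE /= /bump leqNgt ltn_ord add0n (gtn_eqF (ltn_ord k)).
Qed.

Lemma lcred_proj q n (u : Fq q.+1 n.+1) :
  lcred (Fproj q.+1 n u) = Fproj q n (lcred u).
Proof.
by have [x ->] := lcpi_surj u; rewrite lcred_pi /Fproj /= !lcmap_pi lcred_pi.
Qed.

Lemma mult_conj (G H : groupType) (f : {multiplicative G -> H}) g x :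
  f (g * x * g^-1) = f g * f x * (f g)^-1.
Proof. by rewrite !gmulfM multV. Qed.

Lemma aut_conj (G : groupType) (a : aut G) g x :
  a (g * x * g^-1) = a g * a x * (a g)^-1.
Proof. exact: mult_conj. Qed.

(** * Tau-bar as a relation compatible with products *)

Section Taubar.
Variables q n : nat.
Implicit Types (w v : Fq q n) (a b : AFq q.+1 n.+1).

(** By [Fproj_ker] the congruences say that the induced automorphism fixes every generator; [wt] is
    absorbed as [lcred g]. *)
Lemma is_taubarE w a : is_taubar w a <-> restrict a = 1 /\
  exists g, lcred (Fproj q.+1 n g) = w /\
            val a (Flast q.+1 n) = g * Flast q.+1 n * g^-1.
Proof.
have aux i : normal_closure [set Flast q.+1 n]%classic
      (val a (Fgen q.+1 (lift ord_max i)) * (Fgen q.+1 (lift ord_max i))^-1)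
    <-> val (restrict a) (Fgen q.+1 i) = Fgen q.+1 i.
  rewrite -Fproj_ker gmulfM multV -restrictE Fproj_lift.
  by split=> [/divg1_eq|->]; rewrite ?mulgV.
split=> [[a1 [_ [<- [g [<- ag]]]]]|[a1 [g [gw ag]]]].
  split; last by exists g; split=> //; apply: lcred_proj.
  apply/val_inj/autP; rewrite val1.
  by apply: (@Fq_hom_ext _ _ _ (val (restrict a)) idfun) => i; apply/aux.
split=> [i|]; first by apply/aux; rewrite a1.
by exists (lcred g); rewrite -lcred_proj; split=> //; exists g.
Qed.

Lemma is_taubar1 : is_taubar (1 : Fq q n) 1.
Proof.
apply/is_taubarE; split; first exact: mult1.
by exists 1; rewrite mult1 mult1 mul1g invg1 mulg1.
Qed.

Lemma is_taubarM w v a b :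
  is_taubar w a -> is_taubar v b -> is_taubar (w * v) (a * b).
Proof.
move=> /is_taubarE[a1 [g [<- ag]]] /is_taubarE[b1 [h [<- bh]]].
apply/is_taubarE; split; first by rewrite restrictM a1 b1 mulg1.
(* Applying [b] to [g * x_n * g^-1] gives this conjugator; [b] restricts to the identity, so
   [val b g] and [g] have the same projection. *)
exists (val b g * h); split; first by rewrite !gmulfM -restrictE b1.
by rewrite valM autME ag aut_conj bh invgM !mulgA.
Qed.

Lemma is_taubarV w a : is_taubar w a -> is_taubar w^-1 a^-1.
Proof.
move=> /is_taubarE[a1 [g [<- ag]]].
have aV1 : restrict a^-1 = 1 by rewrite multV /= a1 invg1.
apply/is_taubarE; split=> //; exists (val a^-1 g)^-1.
split.
  have -> u : lcred (Fproj q.+1 n u^-1) = (lcred (Fproj q.+1 n u))^-1.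
    by rewrite !multV.
  by rewrite -restrictE aV1.
have aK y : val a (val a^-1 y) = y by rewrite -autME -valM mulVg val1.
have aV y : val a y^-1 = (val a y)^-1 by exact: multV.
apply: (can_inj (autK (val a))); rewrite aut_conj ag aV !aK invgK.
by rewrite !mulgA mulVg mul1g mulgVK.
Qed.

Lemma restrict1_taubar a : restrict a = 1 -> exists w, is_taubar w a.
Proof.
have /asboolP[aC _] := valP a; have [g ag] := aC ord_max => a1.
by exists (lcred (Fproj q.+1 n g)); apply/is_taubarE; split=> //; exists g.
Qed.

Lemma is_taubar_exists :
  (forall j, exists a, is_taubar (Fgen q j : Fq q n) a) ->
  forall w, exists a, is_taubar w a.
Proof.
move=> gen_exists; apply: Fq_ind => [|//|w [a aw]|w v [a aw] [b bv]].
- by exists 1; apply: is_taubar1.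
- by exists a^-1; apply: is_taubarV.
- by exists (a * b); apply: is_taubarM.
Qed.
End Taubar.

(** * Endomorphisms given on generators, and the pure braids realising them on strands *)

Section Endomorphisms.
Variables (q n : nat) (f : 'I_n -> Fq q n).

Definition Fend : {multiplicative Fq q n -> Fq q n} :=
  lcmap q (free_lift (fun i => repr (f i))).

Lemma Fend_gen i : Fend (Fgen q i) = f i.
Proof.
by rewrite /Fend /= /Fgen lcmap_pi /= free_lift_gen /lcpi /quotient_pi reprK.
Qed.
End Endomorphisms.

Lemma Fend_cancel q n (f g : 'I_n -> Fq q n) :
  (forall i, Fend g (f i) = Fgen q i) -> cancel (Fend f) (Fend g).
Proof.
move=> gf; apply: (@Fq_hom_ext _ _ _ (Fend g \o Fend f) idfun) => i /=.
by rewrite Fend_gen gf.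
Qed.

(** The [d^-1] created at index [j] moves to the right past each later factor:
    [d^-1 * (d * x * d^-1) = x * d^-1]. *)
Lemma prod_twist (G : groupType) (x y : nat -> G) (d : G) (j m : nat) :
  (forall i, (i < j)%N -> y i = x i) -> y j = x j * d^-1 ->
  (forall i, (j < i < m)%N -> y i = d * x i * d^-1) -> (j < m)%N ->
  \prod_(0 <= i < m) y i = (\prod_(0 <= i < m) x i) * d^-1.
Proof.
move=> lt_j eq_j; elim: m => // m IHm gt_j.
rewrite ltnS leq_eqVlt !big_nat_recr //= => /orP[/eqP <-|jm].
  rewrite eq_j mulgA; congr (_ * _ * _); apply: eq_big_nat => i /andP[_].
  exact: lt_j.
rewrite gt_j ?jm //= IHm // => [|i /andP[ji im]]; first by rewrite !mulgA mulgVK.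
by rewrite gt_j // ji ltnW.
Qed.

(* The automorphism induced on the fundamental group of the punctured disc by
   the full twist of strands j and n; strands k between j and n are conjugated by
   a commutator. [g] describes the inverse twist. *)
Section PureBraid.
Variables (q n : nat) (j : 'I_n).
Local Notation xj := (Fgen q (lift ord_max j)).
Local Notation xn := (Flast q n).
Local Notation c := (xj * xn).
Local Notation d := (xj * xn * xj^-1 * xn^-1).
Local Notation e := (c^-1 * d^-1 * c).

Let f (i : 'I_n.+1) : Fq q n.+1 :=
  if i == ord_max then c * xn * c^-1
  else if (i == lift ord_max j) then c * xj * c^-1
  else if (i < j)%N then Fgen q i else d * Fgen q i * d^-1.
Let g (i : 'I_n.+1) : Fq q n.+1 :=
  if i == ord_max then c^-1 * xn * c
  else if (i == lift ord_max j) then c^-1 * xj * c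
  else if (i < j)%N then Fgen q i else e * Fgen q i * e^-1.

Let j_neq_n : (lift ord_max j == ord_max :> 'I_n.+1) = false.
Proof. by rewrite eq_sym (negPf (neq_lift _ _)). Qed.

Let fn : Fend f xn = c * xn * c^-1. Proof. by rewrite Fend_gen /f eqxx. Qed.
Let fj : Fend f xj = c * xj * c^-1. Proof. by rewrite Fend_gen /f j_neq_n eqxx. Qed.
Let gn : Fend g xn = c^-1 * xn * c. Proof. by rewrite Fend_gen /g eqxx. Qed.
Let gj : Fend g xj = c^-1 * xj * c. Proof. by rewrite Fend_gen /g j_neq_n eqxx. Qed.

Let reduceg (G : groupType) := (@mulgA G, @invgM G, @invgK G, @mulgK G, @mulgVK G,
  @mulgV G, @mulVg G, @mul1g G, @mulg1 G, @invg1 G).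

Let fK : cancel (Fend f) (Fend g).
Proof.
apply: Fend_cancel => i; rewrite {1}/f; case: eqP => [->|/eqP ni].
  by rewrite !(@gmulfM _ _ (Fend g), @multV _ _ (Fend g)) gn gj !reduceg.
case: eqP => [->|/eqP nj].
  by rewrite !(@gmulfM _ _ (Fend g), @multV _ _ (Fend g)) gn gj !reduceg.
case: ifP => ij; first by rewrite Fend_gen /g (negPf ni) (negPf nj) ij.
(* [Fend g] conjugates both [xj] and [xn] by [c^-1], hence also the word [d]; this dictates the
   choice of [e]. *)
have gd : Fend g d = e^-1.
  by rewrite !(@gmulfM _ _ (Fend g), @multV _ _ (Fend g)) gn gj !reduceg.
rewrite mult_conj gd Fend_gen /g (negPf ni) (negPf nj) ij; move: e => e'.
by rewrite !reduceg.
Qed.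

Let gK : cancel (Fend g) (Fend f).
Proof.
apply: Fend_cancel => i; rewrite {1}/g; case: eqP => [->|/eqP ni].
  by rewrite !(@gmulfM _ _ (Fend f), @multV _ _ (Fend f)) fn fj !reduceg.
case: eqP => [->|/eqP nj].
  by rewrite !(@gmulfM _ _ (Fend f), @multV _ _ (Fend f)) fn fj !reduceg.
case: ifP => ij; first by rewrite Fend_gen /f (negPf ni) (negPf nj) ij.
have fe : Fend f e = d^-1.
  by rewrite !(@gmulfM _ _ (Fend f), @multV _ _ (Fend f)) fn fj !reduceg.
rewrite mult_conj fe Fend_gen /f (negPf ni) (negPf nj) ij; move: d => d'.
by rewrite !reduceg.
Qed.

Definition braid_aut : aut (Fq q n.+1) :=
  Aut (@gmulfM _ _ (Fend f)) (Bijective fK gK).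

Lemma braid_aut_in : Apred q n.+1 braid_aut.
Proof.
apply/asboolP; split=> [i|].
  rewrite /= Fend_gen /f; do 2![case: eqP => [->|_]; first by exists c].
  by case: ifP => _; [exists 1; rewrite invg1 mulg1 mul1g | exists d].
have prodE (h : 'I_n.+1 -> Fq q n.+1) : \prod_(i < n.+1) h i =
    \prod_(0 <= i < n) h (inord i) * h ord_max.
  rewrite big_ord_recr big_mkord; congr (_ * h _); apply: eq_bigr => i _.
  by congr h; apply: val_inj; rewrite /= inordK // ltnS ltnW.
have inordE k : (k < n)%N -> @inord n k = k :> nat.
  by move=> kn; rewrite inordK // ltnS ltnW.
rewrite /fixes_gen_prod; transitivity (\prod_i f i).
  by rewrite [LHS](mult_prod (Fend f)); apply: eq_bigr => i _; apply: Fend_gen.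
have jE : lift ord_max j = j :> nat by rewrite /= /bump leqNgt ltn_ord.
have f_small k : (k < n)%N -> f (inord k) =
    if k == j then c * xj * c^-1
    else if (k < j)%N then Fgen q (inord k) else d * Fgen q (inord k) * d^-1.
  by move=> kn; rewrite /f -!val_eqE [val ord_max]/= [val (lift _ _)]jE
    [val (inord k)]inordE // (ltn_eqF kn) inordE.
(* The image of [xj] is [xj * d^-1] and that of [xn] is [d * xn], so the [d^-1] left by [prod_twist]
   cancels at the last factor. *)
rewrite !prodE (@prod_twist _ (fun k => Fgen q (inord k)) _ d j) //.
- by rewrite -(Fend_gen f) -/(Flast q n) fn !reduceg.
- by move=> k kj; rewrite f_small ?(ltn_eqF kj) ?kj // (ltn_trans kj).
- rewrite f_small // eqxx (_ : inord j = lift ord_max j) ?reduceg //.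
  by apply: val_inj; apply: etrans (inordE _ _) (esym jE).
- move=> k /andP[jk kn]; rewrite f_small // gtn_eqF // ltnNge (ltnW jk) //.
Qed.

Definition braid : AFq q n.+1 := AFqPack braid_aut_in.

Lemma braid_last : val braid (Flast q n) = xj * xn * xj^-1.
Proof. by rewrite /= fn !reduceg. Qed.

(** Once [xn] is killed, [d] becomes trivial and [c] becomes [xj], so every remaining generator is
    fixed. *)
Lemma restrict_braid : restrict braid = 1.
Proof.
apply/val_inj/autP; rewrite val1.
apply: (@Fq_hom_ext _ _ _ (val (restrict braid)) idfun) => i.
rewrite -[LHS]/(Fproj q n (Fend f (Fincl q n (Fgen q i)))) Fincl_gen Fend_gen /f.
have pc : Fproj q n c = Fgen q j.
  by rewrite (@gmulfM _ _ (Fproj q n)) Fproj_last Fproj_lift mulg1.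
have pd : Fproj q n d = 1.
  by rewrite !(@gmulfM _ _ (Fproj q n), @multV _ _ (Fproj q n)) Fproj_last !reduceg.
rewrite eq_sym (negPf (neq_lift _ _)) (inj_eq lift_inj).
case: eqP => [->|_]; first by rewrite mult_conj pc Fproj_lift mulgK.
case: ifP => _; rewrite ?Fproj_lift // mult_conj pd Fproj_lift.
by rewrite invg1 mulg1 mul1g.
Qed.
End PureBraid.

Lemma is_taubar_gen q n (j : 'I_n) : is_taubar (Fgen q j) (braid q.+1 j).
Proof.
apply/is_taubarE; split; first exact: restrict_braid.
exists (Fgen q.+1 (lift ord_max j)); rewrite Fproj_lift lcred_pi; split=> //.
exact: braid_last.
Qed.



(** * The splitting *)

Section Extension.
Variables q n : nat.
Implicit Types a b : aut (Fq q n).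

Definition extend_fun a : {multiplicative Fq q n.+1 -> Fq q n.+1} :=
  Fend (fun i => if unlift ord_max i is Some j then Fincl q n (a (Fgen q j))
                 else Flast q n).

Lemma extend_fun_incl a u : extend_fun a (Fincl q n u) = Fincl q n (a u).
Proof.
move: u; apply: (@Fq_hom_ext _ _ _ (extend_fun a \o Fincl q n) (Fincl q n \o a)) => i.
by rewrite -[LHS]/(extend_fun a (Fincl q n (Fgen q i))) -[RHS]/(Fincl q n (a (Fgen q i)))
  Fincl_gen Fend_gen liftK.
Qed.

Lemma extend_fun_last a : extend_fun a (Flast q n) = Flast q n.
Proof. by rewrite Fend_gen unlift_none. Qed.

Lemma extend_fun1 u : extend_fun 1 u = u.
Proof.
move: u; apply: (@Fq_hom_ext _ _ _ (extend_fun 1) idfun) => i.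
case: (unliftP ord_max i) => [j ->|->]; last exact: extend_fun_last.
by rewrite -Fincl_gen extend_fun_incl.
Qed.

Lemma extend_funM a b u : extend_fun (a * b) u = extend_fun b (extend_fun a u).
Proof.
move: u; apply: (@Fq_hom_ext _ _ _ _ (extend_fun b \o extend_fun a)) => i.
rewrite -[RHS]/(extend_fun b (extend_fun a (Fgen q i))); case: (unliftP ord_max i) => [j ->|->].
  by rewrite -Fincl_gen !extend_fun_incl.
by rewrite !extend_fun_last.
Qed.

Lemma extend_fun_bij a : bijective (extend_fun a).
Proof.
by exists (extend_fun a^-1) => u; rewrite -extend_funM ?mulgV ?mulVg extend_fun1.
Qed.

Definition extend_aut a : aut (Fq q n.+1) :=
  Aut (@gmulfM _ _ (extend_fun a)) (extend_fun_bij a).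

Lemma extend_autE a u : extend_aut a u = extend_fun a u. Proof. by []. Qed.

Lemma extend_in (a : AFq q n) : Apred q n.+1 (extend_aut (val a)).
Proof.
have /asboolP[aC aP] := valP a; apply/asboolP; split=> [i|].
  rewrite extend_autE; case: (unliftP ord_max i) => [j ->|->]; last first.
    by exists 1; rewrite -/(Flast q n) extend_fun_last invg1 mulg1 mul1g.
  have [g ag] := aC j; exists (Fincl q n g).
  by rewrite -Fincl_gen extend_fun_incl ag mult_conj.
have pE : \prod_(i < n.+1) Fgen q i = Fincl q n (\prod_(i < n) Fgen q i) * Flast q n.
  rewrite big_ord_recr mult_prod; congr (_ * _); apply: eq_bigr => i _.
  rewrite Fincl_gen; congr (Fgen q _); apply: val_inj.
  by rewrite /= /bump leqNgt ltn_ord.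
rewrite /fixes_gen_prod pE extend_autE gmulfM extend_fun_last.
by rewrite extend_fun_incl aP.
Qed.

Definition extend (a : AFq q n) : AFq q n.+1 := AFqPack (extend_in a).

Lemma extendM : {morph extend : a b / a * b}.
Proof. by move=> a b; apply/val_inj/autP => u; apply: extend_funM. Qed.
HB.instance Definition _ :=
  isMultiplicative.Build (AFq q n) (AFq q n.+1) extend extendM.

Lemma extendK : cancel extend (@restrict q n).
Proof.
move=> a; apply/val_inj/autP => u.
by rewrite -[LHS]/(Fproj q n (extend_fun _ (Fincl q n u))) extend_fun_incl FinclK.
Qed.
End Extension.

(* Used to normalise g_i, which is only defined up to powers of x_i. *)
Lemma Fgen_power n (i : 'I_n.+1) (k : int) : exists z : Fq 4 n.+1,
  [/\ commute z (Fgen 4 i), mag1 (Fmagnus z) i = k & i = ord_max -> Fproj 4 n z = 1].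
Proof.
suff pow m : exists z : Fq 4 n.+1, [/\ commute z (Fgen 4 i),
    mag1 (Fmagnus z) i = m%:Z%R & i = ord_max -> Fproj 4 n z = 1].
  case: k => m; first exact: pow.
  have [z [zx z1 pz]] := pow m.+1; exists z^-1; split=> [||/pz pz1].
  - exact/commute_sym/commuteV/commute_sym.
  - by rewrite multV mag1V z1 NegzE.
  - by rewrite multV pz1 invg1.
elim: m => [|m [z [zx z1 pz]]].
  by exists 1; split=> [||_]; [apply/commute_sym/commute1|rewrite mult1|rewrite mult1].
exists (z * Fgen 4 i); split=> [||iE].
- by rewrite /commute mulgA -zx.
- by rewrite FmagnusM mag1M z1 Fmagnus_gen /= eqxx -addn1 PoszD.
- by rewrite gmulfM pz // iE Fproj_last mulg1.
Qed.

(** * Injectivity and uniqueness of tau-bar *)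

Lemma is_taubar_eq1 n (w : Fq 3 n) : is_taubar w (1 : AFq 4 n.+1) -> w = 1.
Proof.
move=> /is_taubarE[_ [g [<-]]]; rewrite val1 aut1E => xg.
have m2 := mag2_conj ord_max g; have m3 := mag3_conj ord_max g.
(* Here [g] centralises the last generator, which has no terms of degree two or three. The
   coefficients at words ending in the last letter, and not starting with it, then give those of
   [g]. *)
rewrite -xg Fmagnus_gen /= in m2 m3.
have neq (i : 'I_n) : (ord_max == lift ord_max i) = false by rewrite (negPf (neq_lift _ _)).
apply/lcred_eq1; rewrite Fmagnus_proj; split=> [i|i j].
  by have := m2 (lift ord_max i) ord_max; rewrite eqxx neq mul0r subr0 mulr1.
have := m3 (lift ord_max i) (lift ord_max j) ord_max.
by rewrite eqxx neq !mul0r !subr0 mulr1.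
Qed.

Section Uniqueness.
Variables (n : nat) (a : AFq 4 n.+1) (g : 'I_n.+1 -> Fq 4 n.+1).
Hypothesis restrict_a : restrict a = 1.
Hypothesis aE : forall i, val a (Fgen 4 i) = g i * Fgen 4 i * (g i)^-1.
Hypothesis g_diag : forall i, mag1 (Fmagnus (g i)) i = 0%R.
Hypothesis g_last : lcred (Fproj 4 n (g ord_max)) = 1.
Implicit Types i j k l : 'I_n.+1.
Local Notation max := (@ord_max n).
Local Notation u i := (Fmagnus (g i * Fgen 4 i * (g i)^-1)).
Local Open Scope ring_scope.

(** The projection of [a x_i] is again a generator, which has nothing in degrees two and three. *)
Let restrict_u i : i != max -> forall j k l, j != max -> k != max -> l != max ->
  mag2 (u i) j k = 0 /\ mag3 (u i) j k l = 0.
Proof.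
case: (unliftP max i) => [i' iE|->]; last by rewrite eqxx.
move=> _ j k l; case: (unliftP max j) => [j' ->|->]; last by rewrite eqxx.
case: (unliftP max k) => [k' ->|->]; last by rewrite eqxx.
case: (unliftP max l) => [l' ->|->]; last by rewrite eqxx.
have : Fproj 4 n (g i * Fgen 4 i * (g i)^-1)%g = Fgen 4 i'.
  by rewrite -aE iE -restrictE restrict_a Fproj_lift.
move=> /(congr1 (@Fmagnus n)); rewrite Fmagnus_proj Fmagnus_gen => E _ _ _; split.
- exact: (congr1 (fun m => mag2 m j' k') E).
- exact: (congr1 (fun m => mag3 m j' k' l') E).
Qed.

Let prod_u : (\prod_i u i = \prod_i Fmagnus (Fgen 4 i))%g.
Proof.
have /asboolP[_ aP] := valP a.
have E : (\prod_i (g i * Fgen 4 i * (g i)^-1) = \prod_i Fgen 4 i)%g.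
  by rewrite -[RHS]aP mult_prod; apply: eq_bigr => i _; rewrite -aE.
have := congr1 (@Fmagnus n.+1) E; rewrite (mult_prod (@Fmagnus n.+1)) => ->.
exact: (mult_prod (@Fmagnus n.+1)).
Qed.

Let sum_delta (F : 'I_n.+1 -> int) k :
  (\sum_i F i * (i == k)%:R = F k) * (\sum_i (i == k)%:R * F i = F k).
Proof.
suff E : \sum_i F i * (i == k)%:R = F k.
  by split=> //; rewrite -[RHS]E; apply: eq_bigr => i _; rewrite mulrC.
rewrite (bigD1 k) //= eqxx mulr1 big1 ?addr0 // => i /negPf ->.
by rewrite mulr0.
Qed.

Let u1 i j : mag1 (u i) j = mag1 (Fmagnus (Fgen 4 i)) j.
Proof. by rewrite mag1_conj Fmagnus_gen. Qed.

Lemma conjugator_mag1 i j : mag1 (Fmagnus (g i)) j = 0.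
Proof.
(* Coefficient of [X_l X_k] in the invariant product of the generators. *)
have g_sym k l : mag1 (Fmagnus (g k)) l = mag1 (Fmagnus (g l)) k.
  have : \sum_i (mag2 (u i) l k - mag2 (Fmagnus (Fgen 4 i)) l k) = 0.
    by rewrite -(mag2_prod _ _ _ u1) prod_u subrr.
  under eq_bigr => i' _ do rewrite mag2_conj Fmagnus_gen subr0.
  rewrite sumrB (sum_delta (fun i => mag1 (Fmagnus (g i)) l)).
  rewrite (sum_delta (fun i => mag1 (Fmagnus (g i)) k)).
  by move/eqP; rewrite subr_eq0 => /eqP.
have g_max k : mag1 (Fmagnus (g max)) k = 0.
  case: (unliftP max k) => [k' ->|-> //].
  by have /lcred_eq1[] := g_last; rewrite Fmagnus_proj => /(_ k').
have [->|nij] := eqVneq i j; first exact: g_diag.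
have [->|i_max] := eqVneq i max; first exact: g_max.
have [->|j_max] := eqVneq j max; first by rewrite g_sym g_max.
(* For [i] different from [j], the coefficient of [X_j X_i] in the image of [x_i] is exactly that of
   [X_j] in [g i]. *)
have [] := restrict_u i_max j_max i_max i_max.
by rewrite mag2_conj eqxx (negPf nij) mulr1 mul0r subr0.
Qed.

Let u2 i j k : mag2 (u i) j k = mag2 (Fmagnus (Fgen 4 i)) j k.
Proof. by rewrite mag2_conj !conjugator_mag1 Fmagnus_gen mul0r mulr0 subr0. Qed.

Let u3 i j k l : mag3 (u i) j k l =
  mag2 (Fmagnus (g i)) j k * (i == l)%:R - (i == j)%:R * mag2 (Fmagnus (g i)) k l.
Proof. by rewrite mag3_conj conjugator_mag1 mulr0 subr0. Qed.

Lemma conjugator_mag2 i j k : mag2 (Fmagnus (g i)) j k = 0.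
Proof.
(* Coefficient of [X_q X_r X_p] in the invariant product; it has this simple form because all linear
   parts now vanish. *)
have cyc p q r : mag2 (Fmagnus (g p)) q r = mag2 (Fmagnus (g q)) r p.
  have : \sum_i (mag3 (u i) q r p - mag3 (Fmagnus (Fgen 4 i)) q r p) = 0.
    by rewrite -(mag3_prod _ _ _ _ u1 u2) prod_u subrr.
  under eq_bigr => i' _ do rewrite u3 Fmagnus_gen subr0.
  rewrite sumrB (sum_delta (fun i => mag2 (Fmagnus (g i)) q r)).
  rewrite (sum_delta (fun i => mag2 (Fmagnus (g i)) r p)).
  by move/eqP; rewrite subr_eq0 => /eqP.
have alt p q r : mag2 (Fmagnus (g p)) q r = - mag2 (Fmagnus (g p)) r q.
  exact/Fmagnus_alternating/conjugator_mag1.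
(* The integers have no 2-torsion. Below, [cyc] rotates any repeated index into the last two places,
   where [diag] applies. *)
have diag p q : mag2 (Fmagnus (g p)) q q = 0 by have := alt p q q; lia.
have g_max p q : mag2 (Fmagnus (g max)) p q = 0.
  case: (unliftP max p) => [p' ->|->]; last by rewrite cyc cyc diag.
  case: (unliftP max q) => [q' ->|->]; last by rewrite cyc diag.
  by have /lcred_eq1[_] := g_last; rewrite Fmagnus_proj => /(_ p' q').
have [->|i_max] := eqVneq i max; first exact: g_max.
have [->|j_max] := eqVneq j max; first by rewrite cyc g_max.
have [->|k_max] := eqVneq k max; first by rewrite -cyc g_max.
have [->|nij] := eqVneq i j; first by rewrite cyc cyc diag.
have [_] := restrict_u i_max j_max k_max i_max.
by rewrite u3 eqxx (negPf nij) mulr1 mul0r subr0.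
Qed.

(** Every [g i] now lies in [F_3 / F_4], which is central in [F / F_4], so conjugation by it is
    trivial. *)
Lemma conjugators_trivial : a = 1%g.
Proof.
apply/val_inj/autP; rewrite val1.
apply: (@Fq_hom_ext _ _ _ (val a) idfun) => i; rewrite [LHS]aE.
have /lcred_eq1_commute -> : lcred (g i) = 1%g.
  by apply/lcred_eq1; split=> *; rewrite (conjugator_mag1, conjugator_mag2).
exact: mulgK.
Qed.
End Uniqueness.

Lemma is_taubar1_eq1 n (a : AFq 4 n.+1) : is_taubar (1 : Fq 3 n) a -> a = 1.
Proof.
move=> /is_taubarE[a1 [g0 [g01 ag0]]].
have /asboolP[aC _] := valP a.
have conjugator i : exists g, [/\ val a (Fgen 4 i) = g * Fgen 4 i * g^-1,
    mag1 (Fmagnus g) i = 0%R & i = ord_max -> lcred (Fproj 4 n g) = 1].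
  have [g [ag g1]] : exists g, val a (Fgen 4 i) = g * Fgen 4 i * g^-1 /\
      (i = ord_max -> lcred (Fproj 4 n g) = 1).
    have [->|/eqP ni] := eqVneq i ord_max; first by exists g0.
    by have [g ag] := aC i; exists g.
  (* A factor commuting with [x_i] leaves the conjugate unchanged and cancels the diagonal
     coefficient; at the last index its projection is trivial, which preserves the condition on
     [g]. *)
  have [z [zx z1 pz]] := Fgen_power i (- mag1 (Fmagnus g) i)%R.
  exists (g * z); split=> [||im].
  - by rewrite ag invgM !mulgA -(mulgA g z) zx !mulgA mulgK.
  - by rewrite FmagnusM mag1M z1 subrr.
  - by rewrite gmulfM pz // mulg1 g1.
have [g gP] := choice conjugator.
apply: (@conjugators_trivial n a g) => // [i|i|]; first by have [] := gP i.
- by have [] := gP i.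
- by have [_ _ ->] := gP ord_max.
Qed.

(* The integer n of the sequence is written n.+1, so F^3(n-1) is [Fq 3 n]. *)
Theorem theorem1 (n : nat) (hn : (2 <= n.+1)%N) :
  exists taubar : {multiplicative Fq 3 n -> AFq 4 n.+1},
    (forall (w : Fq 3 n) (a : AFq 4 n.+1), is_taubar w a <-> a = taubar w) /\
    split_exact taubar (@restrict 4 n).
Proof.
have gen_exists j : exists a, is_taubar (Fgen 3 j : Fq 3 n) a.
  by exists (braid 4 j); apply: is_taubar_gen.
have [t tP] := choice (is_taubar_exists gen_exists).
have tE w a : is_taubar w a <-> a = t w.
  split=> [wa|->]; last exact: tP.
  (* Two automorphisms attached to [w] differ by one attached to [w * w^-1 = 1]. *)
  apply: divg1_eq; apply: is_taubar1_eq1; rewrite -(mulgV w).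
  exact/is_taubarM/is_taubarV.
have tM : {morph t : w v / w * v}.
  by move=> w v; apply/esym/tE/is_taubarM.
pose tm := isMultiplicative.Build _ _ t tM.
pose taubar : {multiplicative Fq 3 n -> AFq 4 n.+1} := HB.pack t tm.
exists taubar; split; first exact: tE.
split.
- move=> w v twv; apply: divg1_eq; apply: is_taubar_eq1.
  (* If [t w = t v], the identity is attached to [w * v^-1], which [is_taubar_eq1] forces to be
     trivial. *)
  rewrite -(mulgV (t w)) {2}(twv : t w = t v).
  exact/is_taubarM/is_taubarV.
- apply/seteqP; split=> [_ [w _ <-]|a /restrict1_taubar[w /tE ->]].
    by have /is_taubarE[] := tP w.
  by exists w.
- by move=> a; exists (extend a); apply: extendK.
- by exists (@extend 4 n); apply: extendK.
Qed.
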